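(* Let $K$ be a quasi-metric kernel on $X$ with constant $\kappa$, let $\sigma\in\mathcal M_+(X)$, and fix $1<q<\infty$, $\frac1p+\frac1q=1$. Then there is a constant $C=C(\kappa)$ (depending only on $\kappa$ and on the fixed exponent $q$) such that if $\omega\in\mathcal M_+(X)$ satisfies $K\omega\in\mathcal Z_{q,K}$, then for every $x\in X$, $$\sup_{a>0}\left\{\int_0^a\frac{|B_t(x)|_\sigma}{t^2}\,dt\right\}^{p/q}\left\{\int_a^\infty\frac{|B_t(x)|_\omega}{t^2}\,dt\right\}\le C\,\|K\omega\|_{\mathcal Z}.$$
   Context: $X$ is a metric space and $\mathcal M_+(X)$ is the set of positive $\sigma$-finite Borel measures on $X$; $\sigma$ is the underlying measure. $|E|_\mu=\mu(E)$. $L^0_+(\sigma)$ is the set of ($\sigma$-a.e. classes of) Borel functions $X\to[0,\infty)$. A quasi-metric kernel with constant $\kappa\ge1$ is a Borel function $K:X\times X\to(0,\infty]$ that is symmetric and satisfies $\frac1{K(x,y)}\le\kappa\big(\frac1{K(x,z)}+\frac1{K(z,y)}\big)$ for all $x,y,z\in X$. Put $\rho(x,y)=1/K(x,y)$ ($\rho(x,x)>0$ is allowed) and $B_a(x)=\{y\in X:\rho(x,y)\le a\}$. For $\mu\in\mathcal M_+(X)$, $K\mu(x)=\int_X K(x,y)\,d\mu(y)$; for a nonnegative Borel function $f$, $Kf(x)=\int_X K(x,y)f(y)\,d\sigma(y)$. $S=S_{q,K}$ is the set of $f\in L^0_+(\sigma)$ for which there is $u\in L^0_+(\sigma)$ with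 $u=Ku^q+f$ $\sigma$-a.e.; $\mathcal Z_{q,K}=\{f:\epsilon|f|\in S\text{ for some }\epsilon>0\}$ and $\|f\|_{\mathcal Z}=\inf\{\alpha>0:\alpha^{-1}|f|\in S\}$. The usual convention $0\cdot\infty=0$ is used. *)

(* Defs.v *)
From HB Require Import structures.
From mathcomp Require Import all_boot all_order all_algebra.
From mathcomp Require Import all_classical all_reals all_analysis.
From mathcomp Require Import measurable_realfun.

Set Implicit Arguments.
Unset Strict Implicit.
Unset Printing Implicit Defensive.

Import Order.TTheory GRing.Theory Num.Theory.
Import numFieldNormedType.Exports.

Local Open Scope classical_set_scope.
Local Open Scope ring_scope.
Local Open Scope ereal_scope.

(* Measurable types are pointed in the library, hence the base point. It only
   excludes the empty space, on which a statement about every x is vacuous. *)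
#[short(type="pointedMetricType")]
HB.structure Definition PointedMetric (K : numDomainType) :=
  { M of Metric K M & Pointed M }.

(* For T := (X * X)%type this is the Borel sigma-algebra of the product
   topology, which may be larger than the product of the Borel sigma-algebras
   when X is not separable. *)
Notation borel T := (g_sigma_algebraType (@open T%type)).

Section Kernels.
Context {R : realType} {X : pointedMetricType R}.
Implicit Types (K : X -> X -> \bar R) (q kappa a e : R).
Implicit Types mu sigma : {sigma_finite_measure set (borel X) -> \bar R}.

(* The library's inverse on \bar R satisfies +oo^-1 = 0. *)
Record quasi_metric_kernel kappa K : Prop := QuasiMetricKernel {
  kernel_borel : measurable_fun [set: borel (X * X)]
    (fun z : borel (X * X) => K z.1 z.2) ;
  kernel_gt0 : forall x y, 0 < K x y ;
  kernel_sym : forall x y, K x y = K y x ;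
  kernel_quasi : forall x y z,
    (K x y)^-1 <= kappa%:E * ((K x z)^-1 + (K z y)^-1) }.

Definition rho K (x y : X) : \bar R := (K x y)^-1.

Definition kball K a (x : X) : set (borel X) := [set y | rho K x y <= a%:E].

Definition potential K mu (x : X) : \bar R := \int[mu]_y K x y.

Definition kernel_op K sigma (f : X -> \bar R) (x : X) : \bar R :=
  \int[sigma]_y (K x y * f y).

(* A class in L^0 is represented by any function X -> \bar R that agrees
   sigma-a.e. with a finite Borel function; this applies to potentials, which
   are extended-real valued. *)
Definition L0 sigma : set (X -> \bar R) :=
  [set f | exists2 g : borel X -> R, measurable_fun setT g &
    f = EFin \o g %[ae sigma]].

Definition borel_nonneg : set (borel X -> R) :=
  [set u : borel X -> R | measurable_fun setT u /\ forall x, (0 <= u x)%R].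

Definition L0_plus sigma : set (X -> \bar R) :=
  [set f | exists2 g, borel_nonneg g & f = EFin \o g %[ae sigma]].

(* The solution u is a genuine Borel representative of its class, so that the
   integral defining K(u^q) is that of a measurable function. *)
Definition S_class q K sigma : set (X -> \bar R) :=
  [set f | L0_plus sigma f /\
    exists2 u, borel_nonneg u &
      \forall x \ae sigma,
        (u x)%:E = kernel_op K sigma (fun y => (u y `^ q)%:E) x + f x].

Definition Z_class q K sigma : set (X -> \bar R) :=
  [set f | L0 sigma f /\
    exists2 e : R, (0 < e)%R & S_class q K sigma (fun x => e%:E * `|f x|)].

Definition Z_norm q K sigma (f : X -> \bar R) : \bar R :=
  ereal_inf [set a%:E | a in
    [set a : R | (0 < a)%R /\
      S_class q K sigma (fun x => (a^-1)%:E * `|f x|)]].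

End Kernels.

(* Main.v *)
Require Import Defs.
From HB Require Import structures.
From mathcomp Require Import all_boot all_order all_algebra.
From mathcomp Require Import all_classical all_reals all_analysis.
From mathcomp Require Import measurable_realfun.
From mathcomp Require Import ring.
Import Order.TTheory GRing.Theory Num.Theory.
Import numFieldNormedType.Exports.
Local Open Scope classical_set_scope.
Local Open Scope ring_scope.
Local Open Scope ereal_scope.

(** Write B_t for the ball of radius t about the given point x, F t for
    sigma(B_t) / t^2 and I for the integral of omega(B_t) / t^2 over ]a, +oo[.
    Let alpha > 0 be such that K omega / alpha belongs to S, with solution
    u = K(u^q) + K omega / alpha. It suffices to bound the product, for this
    alpha, by a constant times alpha; the constant depends on kappa and q only.

    The quasi-metric inequality makes K(y, z) comparable from below with
    min(1/r, K(x, z)) for every y in B_r, up to the factor 1/(2 kappa)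
    (kernel_ge_ball). By Fubini the integral of min(1/r, K(x, .)) against a
    measure mu is the integral of mu(B_t) / t^2 over ]r, +oo[ (layer_cake).
    Hence everything reduces to the radial variable t, in two ways.

    (i) On B_a, u >= K omega / alpha >= lam := I / (2 kappa alpha).

    (ii) If u >= lam a.e. on B_b, then K(u^q) >= lam^q K(1_{B_b}), so that
    u >= lam^q / (2 kappa) times the integral of F over ]r, b], a.e. on B_r
    (ball_gain).

    Statement (ii) bootstraps. An amount 4 kappa / lam^(q-1) of F-mass,
    used on some ]c, b], doubles the lower bound for u on B_c; the next doubling
    costs 2^(q-1) times less because lam is replaced by 2 lam. The costs form a
    convergent geometric series, whose sum is blowup_mass lam, so an interval
    ]r, b] with that much mass would allow infinitely many doublings and force
    u = +oo a.e. on B_r (ball_blowup). As u is finite, this is impossible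
    whenever sigma(B_r) > 0, and letting r decrease bounds the integral of F
    over ]0, a] by blowup_mass lam = const / lam^(q-1) (ball_mass_le). Raising
    this to the power p / q = 1 / (q - 1) and multiplying by
    I = 2 kappa alpha lam, the powers of lam cancel and the bound const * alpha
    remains. *)

(** * Layer-cake formula *)

Lemma measurable_powN2 {R : realType} (r : R) (hr : (0 <= r)%R) (b : itv_bound R) :
  measurable_fun [set` Interval (BRight r) b] (fun t : R => t ^- 2).
Proof.
apply: (eq_measurable_fun (fun t : R => t `^ (- 2%:R))%R).
  move=> t; rewrite inE/= in_itv/= => /andP[rt _].
  by rewrite powRN powR_mulrn// (le_trans hr)// ltW.
by apply: measurable_funTS; exact: measurable_powR.
Qed.

Lemma integral_powN2 {R : realType} (r : R) (hr : (0 < r)%R) :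
  \int[lebesgue_measure]_(t in `]r, +oo[) (t ^- 2)%:E = (r^-1)%:E.
Proof.
rewrite integral_itv_obnd_cbnd; last first.
  by apply/measurable_EFinP; apply: measurable_powN2; exact: ltW.
have gt0 (t : R) : (r <= t -> 0 < t)%R by apply: lt_le_trans.
have dV (t : R) : (r <= t)%R -> is_derive t (1%R : R) (fun u : R => - u^-1)%R (t ^- 2)%R.
  move=> /gt0 t0; have t1 : id t != 0%R by rewrite gt_eqF.
  apply: is_derive_eq; first by apply: is_deriveN; exact: (is_deriveV t1).
  by rewrite /= scaleNr opprK /GRing.scale/= mulr1.
have cV (t : R) : (r <= t)%R -> {for t, continuous (fun u : R => - u^-1)%R}.
  by move=> /gt0 t0; apply: cvgN; apply: inv_continuous; rewrite gt_eqF.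
rewrite (@ge0_continuous_FTC2y R _ (fun t => - t^-1)%R r 0%R).
- by rewrite -EFinD opprK add0r.
- by move=> t _; rewrite invr_ge0 exprn_even_ge0.
- apply: continuous_in_subspaceT => t; rewrite inE/= in_itv/= andbT => rt.
  apply: (@cvgV _ _ _ _ (fun t : R => t ^+ 2)%R).
    by rewrite expf_neq0// gt_eqF// gt0.
  exact: exprn_continuous.
- rewrite -oppr0; apply: cvgN; apply/gtr0_cvgV0; last exact: cvg_id.
  exact: nbhs_pinfty_gt.
- by move=> t /ltW /dV [].
- exact/cvg_at_right_filter/cV.
- move=> t; rewrite in_itv/= andbT => /ltW /dV td.
  by rewrite derive1E; apply: derive_val.
Qed.

Lemma mine_inv {R : realType} (r s : R) : (0 < r)%R -> (0 < s)%R ->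
  mine (r^-1)%:E s%:E = ((Num.max r s^-1)^-1)%:E.
Proof.
move=> r0 s0; have s10 : (0 < s^-1)%R by rewrite invr_gt0.
have [rs|/ltW sr] := leP s^-1%R r.
  by rewrite -EFin_min min_l// -[leRHS]invrK lef_pV2 ?posrE.
by rewrite -EFin_min min_r ?invrK// -[leLHS]invrK lef_pV2 ?posrE.
Qed.

Lemma measurable_epigraph_inv {d} {T : measurableType d} {R : realType}
    (k : T -> \bar R) : measurable_fun setT k ->
  measurable [set zt : T * R | 1 <= zt.2%:E * k zt.1].
Proof.
move=> mk; rewrite -[X in measurable X]setTI; apply: emeasurable_fun_c_infty => //.
apply: emeasurable_funM; first by apply/measurable_EFinP; exact: measurable_snd.
by apply: (measurableT_comp mk); exact: measurable_fst.
Qed.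

(** For fixed z, the condition 1 <= t * k z selects the t >= 1 / k z, so the
    integral of t^-2 over the selected t > r is the inverse of the larger of r
    and 1 / k z. The condition is written as a product because this form stays
    correct when k z = +oo and is jointly measurable in (z, t). *)
Lemma layer_cake {d} {T : measurableType d} {R : realType}
    (mu : {sigma_finite_measure set T -> \bar R}) (D : set T) (k : T -> \bar R)
    (r : R) :
  (0 < r)%R -> measurable D -> measurable_fun setT k -> (forall z, 0 < k z) ->
  \int[lebesgue_measure]_(t in `]r, +oo[)
      (mu (D `&` [set z | 1 <= t%:E * k z]) * (t ^- 2)%:E) =
  \int[mu]_(z in D) mine (r^-1)%:E (k z).
Proof.
move=> r0 mD mk k0.
pose A := [set zt : T * R | [/\ D zt.1, `]r, +oo[%classic zt.2 & 1 <= zt.2%:E * k zt.1]].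
(* t `^ (-2) agrees with t ^- 2 for t > 0 and is measurable on the whole line *)
pose w (t : R) := (t `^ (- 2%:R))%R.
have wE t : (`]r, +oo[)%classic t -> w t = (t ^- 2)%R.
  rewrite /= in_itv/= andbT => rt.
  by rewrite /w powRN powR_mulrn// ltW// (lt_trans r0).
have mA : measurable A.
  have -> : A = (D `*` `]r, +oo[) `&` [set zt | 1 <= zt.2%:E * k zt.1].
    by apply/seteqP; split=> -[z t] /= []; rewrite /A/=; [move=> ? ? ?|move=> [? ?] ?]; split.
  by apply: measurableI; [exact: measurableX|exact: measurable_epigraph_inv].
pose f (zt : T * R) : \bar R := (w zt.2)%:E * (\1_A zt)%:E.
have f0 zt : 0 <= f zt by rewrite mule_ge0// lee_fin// powR_ge0.
have mf : measurable_fun setT f.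
  apply: emeasurable_funM; apply/measurable_EFinP; last exact: measurable_indic.
  have mw : measurable_fun setT w by exact: measurable_powR.
  by apply: (measurableT_comp mw); exact: measurable_snd.
have := @fubini_tonelli _ _ T (measurableTypeR R) R mu lebesgue_measure f mf f0.
move=> /esym fub.
pose B (t : R) := [set z | 1 <= t%:E * k z].
have mB (t : R) : measurable (B t).
  rewrite /B -[X in measurable X]setTI; apply: emeasurable_fun_c_infty => //.
  exact: measurable_funeM.
rewrite integral_mkcond [RHS]integral_mkcond.
transitivity (\int[lebesgue_measure]_y \int[mu]_x f (x, y)).
  apply: eq_integral => t _; rewrite patchE; case: ifPn => [|]; rewrite (inE,notin_setE) => tr.
    have fE x : f (x, t) = (w t)%:E * (\1_(D `&` B t) x)%:E.
      rewrite /f/=; congr (_ * (_%:R)%:E); congr (nat_of_bool _).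
      by apply/idP/idP; rewrite !inE /A/= => -[].
    under eq_integral do rewrite fE.
    rewrite ge0_integralZl_EFin ?powR_ge0//; last first.
      apply/measurable_EFinP; apply: measurable_indic; exact: measurableI.
    by rewrite integral_indic ?setIT ?wE// 1?muleC//; exact: measurableI.
  rewrite integral0_eq// => z _.
  by rewrite /f indicE memNset ?mule0// => -[].
rewrite fub; apply: eq_integral => z _.
rewrite patchE; case: ifPn; rewrite (inE,notin_setE) => zD; last first.
  by rewrite integral0_eq// => t _; rewrite /f indicE memNset ?mule0// => -[].
have fE (t : R) : f (z, t) = ((fun t : R => (t ^- 2)%:E) \_
    (`]r, +oo[ `&` [set t : R | 1 <= t%:E * k z])) t.
  rewrite /f/= patchE indicE; case: ifPn => [|]; rewrite (inE,notin_setE) => tz.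
    by rewrite mem_set ?mule1 ?wE//; case: tz.
  by rewrite memNset ?mule0// => -[/= ? ? ?]; apply: tz.
under eq_integral do rewrite fE.
rewrite -integral_mkcond.
have V0 (s : R) : (0 < s -> 0 < s^-1)%R by rewrite invr_gt0.
case: (k z) (k0 z) => [s||]// => [|_]; last first.
  rewrite (_ : _ `&` _ = `]r, +oo[%classic) ?integral_powN2// ?miney//.
  apply/seteqP; split=> t /=; first by case.
  rewrite in_itv/= andbT => rt; split=> //.
  by rewrite mulry gtr0_sg ?mul1e ?leey// (lt_trans r0).
rewrite lte_fin => s0.
rewrite mine_inv// -integral_powN2 ?lt_max ?r0//.
have [rs|sr] := leP s^-1%R r.
  congr (integral _ _ _); apply/seteqP; split=> t /=; first by case.
  rewrite in_itv/= andbT => rt; split=> //.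
  rewrite -EFinM lee_fin -ler_pdivrMr// div1r ltW//.
  exact: le_lt_trans rt.
rewrite [RHS]integral_itv_obnd_cbnd; last first.
  by apply/measurable_EFinP; apply: measurable_powN2; exact/ltW/V0.
congr (integral _ _ _); apply/seteqP; split=> t /=; rewrite !in_itv/= !andbT.
  by move=> [_]; rewrite -EFinM lee_fin -ler_pdivrMr// div1r.
move=> st; split; first exact: lt_le_trans st.
by rewrite -EFinM lee_fin -ler_pdivrMr// div1r.
Qed.

(** * Quasi-metric kernels and balls *)

Section Kernel.
Context {R : realType} {X : pointedMetricType R}.
Implicit Types (K : X -> X -> \bar R) (kappa : R) (x y z : X).

Lemma measurable_kernel_section kappa K (y : X) :
  quasi_metric_kernel kappa K -> measurable_fun setT (K y : borel X -> \bar R).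
Proof.
move=> [mK _ _ _].
have mp : measurable_fun [set: borel X] (fun z : borel X => (y, z) : borel (X * X)).
  apply: (measurability (@open (X * X)%type : set (set (borel (X * X))))) => //.
  move=> _ [U oU <-]; rewrite setTI; apply: sub_sigma_algebra.
  apply: open_comp oU => z _.
  exact: (cvg_pair (cvg_cst _) cvg_id).
exact: (measurableT_comp mK mp).
Qed.

(** On [0, +oo], rho(x, z) <= t is the same as 1 <= t * K(x, z); the second form
    is the one handled by layer_cake. *)
Lemma kballE K (x : X) (t : R) : (0 < t)%R -> (forall z, 0 < K x z) ->
  kball K t x = [set z | 1 <= t%:E * K x z].
Proof.
move=> t0 K0; apply/seteqP; split=> z; rewrite /kball /rho /=.
all: rewrite inve_ple ?inE ?lee_fin; [|exact: ltW..].
all: rewrite inver gt_eqF//.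
all: case: (K x z) (K0 z) => [s||]//; rewrite ?lte_fin => s0.
- by rewrite -EFinM !lee_fin mulrC -ler_pdivrMr ?div1r.
- by rewrite mulry gtr0_sg ?mul1e ?leey.
- by rewrite -EFinM !lee_fin mulrC -ler_pdivrMr ?div1r.
- by rewrite leey.
Qed.

Lemma measurable_kball kappa K (x : X) (t : R) : (0 < t)%R ->
  quasi_metric_kernel kappa K -> measurable (kball K t x).
Proof.
move=> t0 QK; rewrite kballE//; last by move=> z; exact: (kernel_gt0 QK).
rewrite -[X in measurable X]setTI; apply: emeasurable_fun_c_infty => //.
apply: measurable_funeM; exact: measurable_kernel_section QK.
Qed.

Lemma subset_kball K (x : X) (s t : R) : (s <= t)%R -> kball K s x `<=` kball K t x.
Proof. by move=> st y /le_trans; apply; rewrite lee_fin. Qed.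

(** By the quasi-metric inequality through x, rho(y, z) is at most
    kappa (r + rho(x, z)), hence at most 2 kappa max(r, rho(x, z)). *)
Lemma kernel_ge_ball kappa K (x y z : X) (r : R) : (1 <= kappa)%R ->
  quasi_metric_kernel kappa K -> (0 < r)%R -> kball K r x y ->
  ((2 * kappa)^-1)%:E * mine (r^-1)%:E (K x z) <= K y z.
Proof.
move=> k1 QK r0; rewrite /kball/= /rho => xy.
have K0 := kernel_gt0 QK.
have kap0 : (0 < kappa)%R := lt_le_trans ltr01 k1.
have := kernel_quasi QK y z x; rewrite (kernel_sym QK y x).
case: (K x z) (K0 x z) => [s||]//; last first.
  move=> _; rewrite invey adde0 miney => yz.
  have {}yz : (K y z)^-1 <= (kappa * r)%:E.
    by rewrite (le_trans yz)// EFinM lee_pmul2l// lte_fin.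
  move: yz; rewrite inve_ple; last 2 first.
  - by rewrite inE ltW.
  - by rewrite inE lee_fin mulr_ge0// ltW.
  rewrite inver gt_eqF ?mulr_gt0//.
  apply: le_trans; rewrite -EFinM lee_fin -invfM lef_pV2 ?posrE ?mulr_gt0//.
  by rewrite ler_pM2r// ler_pMl// ler1n.
rewrite lte_fin => s0; rewrite inver gt_eqF// => yz.
rewrite mine_inv//; set m := Num.max r _.
have rm : (r <= m)%R by rewrite le_max lexx.
have sm : (s^-1 <= m)%R by rewrite le_max lexx orbT.
have m0 : (0 < m)%R := lt_le_trans r0 rm.
have {}yz : (K y z)^-1 <= (2 * kappa * m)%:E.
  rewrite (le_trans yz)// mulrAC mulrC EFinM lee_pmul2l ?lte_fin//.
  rewrite mulr_natl mulr2n EFinD leeD ?lee_fin//.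
  by rewrite (le_trans xy)// lee_fin.
rewrite -EFinM -invfM.
move: yz; rewrite inve_ple; last 2 first.
- by rewrite inE ltW.
- by rewrite inE lee_fin !mulr_ge0// ltW.
by rewrite inver gt_eqF ?mulr_gt0.
Qed.

(** The bridge from potentials to the radial variable. The extra set D serves
    to truncate mu to a ball. *)
Lemma potential_ge_ball kappa K (mu : {sigma_finite_measure set (borel X) -> \bar R})
    (D : set (borel X)) (x y : X) (r : R) : (1 <= kappa)%R ->
  quasi_metric_kernel kappa K -> (0 < r)%R -> kball K r x y -> measurable D ->
  ((2 * kappa)^-1)%:E *
    \int[lebesgue_measure]_(t in `]r, +oo[) (mu (D `&` kball K t x) * (t ^- 2)%:E)
  <= \int[mu]_(z in D) K y z.
Proof.
move=> k1 QK r0 xy mD.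
have kap0 : (0 < kappa)%R := lt_le_trans ltr01 k1.
have K0 := kernel_gt0 QK.
have mK u := @measurable_kernel_section kappa K u QK : measurable_fun setT (K u : borel X -> _).
have -> : \int[lebesgue_measure]_(t in `]r, +oo[) (mu (D `&` kball K t x) * (t ^- 2)%:E)
    = \int[mu]_(z in D) mine (r^-1)%:E (K x z).
  rewrite -(layer_cake mu D (K x) r r0 mD (mK x) (K0 x)).
  apply: eq_integral => t; rewrite inE/= in_itv/= andbT => rt.
  by rewrite kballE// (lt_trans r0).
rewrite -ge0_integralZl//; first last.
- by rewrite lee_fin invr_ge0 mulr_ge0// ltW.
- by move=> z _; rewrite le_min lee_fin invr_ge0 !ltW.
- apply: measurable_mine; first exact: measurable_cst.
  by apply: measurable_funTS; exact: mK.
apply: ge0_le_integral => //.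
- move=> z _; rewrite mule_ge0// ?lee_fin ?invr_ge0 ?mulr_ge0 ?(ltW kap0)//.
  by rewrite le_min lee_fin invr_ge0 !ltW.
- apply: measurable_funeM; apply: measurable_mine; first exact: measurable_cst.
  by apply: measurable_funTS; exact: mK.
- exact: (measurable_funTS (mK y)).
- by move=> z _; exact: kernel_ge_ball.
Qed.

End Kernel.

(** * Integrals over half-open intervals *)

Section Tails.
Context {R : realType}.

Lemma integral_itvoc_split (f : R -> \bar R) (r c b : R) : (r <= c <= b)%R ->
  measurable_fun `]r, b] f -> (forall t, (r < t <= b)%R -> 0 <= f t) ->
  \int[lebesgue_measure]_(t in `]r, b]) f t =
  \int[lebesgue_measure]_(t in `]r, c]) f t +
  \int[lebesgue_measure]_(t in `]c, b]) f t.
Proof.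
move=> /andP[rc cb] mf f0.
have bU : `]r, b]%classic = `]r, c] `|` `]c, b] by apply: itv_bndbnd_setU; rewrite bnd_simp.
rewrite bU ge0_integral_setU -?bU//.
apply/disj_setPS => t [] /=; rewrite !in_itv/= => /andP[_ tc] /andP[ct _].
by have := lt_le_trans ct tc; rewrite ltxx.
Qed.

(** The bound M makes f integrable, so that its primitive is continuous. *)
Lemma integral_tail_IVT (f : R -> \bar R) (r b M v : R) : (r <= b)%R -> (0 <= M)%R ->
  measurable_fun `]r, b] f -> (forall t, (r < t <= b)%R -> 0 <= f t <= M%:E) ->
  (0 <= v)%R -> v%:E <= \int[lebesgue_measure]_(t in `]r, b]) f t ->
  exists2 c : R, (r <= c <= b)%R & \int[lebesgue_measure]_(t in `]c, b]) f t = v%:E.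
Proof.
move=> rb M0 mf fM v0 vf.
pose g (t : R) := fine ((f \_ `]r, b]) t).
have mg : measurable_fun setT g.
  have mfine : measurable_fun [set: \bar R] fine by exact: fine_measurable.
  apply: (measurableT_comp mfine).
  by apply/(measurable_restrictT f).
have gE t : (r < t <= b)%R -> (g t)%:E = f t.
  move=> rtb; rewrite /g patchE mem_set/= ?in_itv//.
  have /andP[f0 fm] := fM _ rtb.
  by rewrite fineK// ge0_fin_numE// (le_lt_trans fm) ?ltry.
have gM t : (`|g t| <= M)%R.
  have [rtb|rtb] := boolP (r < t <= b)%R.
    have /andP[] := fM _ rtb; rewrite -gE// !lee_fin => g0 gm.
    by rewrite ger0_norm.
  by rewrite /g patchE memNset/= ?in_itv ?normr0//; exact/negP.
have gI : lebesgue_measure.-integrable `[r, b] (EFin \o g).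
  apply: measurable_bounded_integrable => //.
  - by rewrite /= lebesgue_measure_itv/=; case: ifP => _; rewrite -?EFinB ltry.
  - exact: measurable_funTS.
  - by exists M; split; [exact: num_real|move=> N MN t _; exact: le_trans (gM t) (ltW MN)].
have intE c : (r <= c <= b)%R -> \int[lebesgue_measure]_(t in `]c, b]) f t =
    (\int[lebesgue_measure]_(t in `]c, b]) g t)%R%:E.
  move=> /andP[rc cb]; rewrite fineK.
    apply: eq_integral => t; rewrite inE/= in_itv/= => /andP[ct tb].
    by rewrite gE// (le_lt_trans rc).
  apply: integrable_fin_num => //; apply: integrableS gI => //.
  by apply: subset_itv; rewrite bnd_simp.
have IE c : (r <= c <= b)%R -> (parameterized_integral lebesgue_measure r b g -
    parameterized_integral lebesgue_measure r c g =
    \int[lebesgue_measure]_(t in `]c, b]) g t)%R.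
  by move=> /andP[rc cb]; rewrite /parameterized_integral Rintegral_itvB ?bnd_simp.
have Pr : parameterized_integral lebesgue_measure r r g = 0%R.
  by rewrite /parameterized_integral set_itv1 Rintegral_set1.
have rrb : (r <= r <= b)%R by rewrite lexx.
have vP : (v <= parameterized_integral lebesgue_measure r b g)%R.
  by move: vf; rewrite intE// lee_fin -IE// Pr subr0.
have P0 := le_trans v0 vP.
have [|c + Pc] := @IVT R (fun s => parameterized_integral lebesgue_measure r s g) r b
  (parameterized_integral lebesgue_measure r b g - v)%R rb
  (parameterized_integral_continuous rb gI).
  by rewrite Pr min_l// max_r// subr_ge0 vP gerBl.
rewrite in_itv/= => rcb; exists c => //.
by rewrite intE// -IE// Pc subKr.
Qed.

End Tails.

(** * The radial density of a measure *)

Section BallDensity.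
Context {R : realType} {X : pointedMetricType R}.
Context (kappa : R) (K : X -> X -> \bar R).
Context (mu : {sigma_finite_measure set (borel X) -> \bar R}) (x : X).
Context (QK : quasi_metric_kernel kappa K).

Definition ball_density (t : R) : \bar R := mu (kball K t x) * (t ^- 2)%:E.

Lemma ball_density_ge0 t : 0 <= ball_density t.
Proof. by rewrite mule_ge0// lee_fin invr_ge0 exprn_even_ge0. Qed.

Lemma le_measure_kball s t : (0 < s)%R -> (s <= t)%R -> mu (kball K s x) <= mu (kball K t x).
Proof.
move=> s0 st; apply: le_measure; rewrite ?inE.
- exact: measurable_kball QK.
- by apply: measurable_kball QK; exact: lt_le_trans st.
- exact: subset_kball.
Qed.

Lemma measurable_ball_densityI (D : set (borel X)) (r : R) (b : itv_bound R) :
  measurable D -> (0 <= r)%R ->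
  measurable_fun [set` Interval (BRight r) b]
    (fun t => mu (D `&` kball K t x) * (t ^- 2)%:E).
Proof.
move=> mD r0; apply: emeasurable_funM; last first.
  by apply/measurable_EFinP; exact: measurable_powN2.
have mK := measurable_kernel_section kappa K x QK.
pose A := (D `*` setT) `&` [set zt : borel X * R | 1 <= zt.2%:E * K x zt.1].
have mA : measurable A.
  by apply: measurableI; [exact: measurableX|exact: measurable_epigraph_inv].
apply: (eq_measurable_fun (mu \o ysection A)); last first.
  by apply: measurable_funTS; exact: (measurable_fun_ysection mu mA).
move=> t; rewrite inE/= in_itv/= => /andP[rt _].
rewrite kballE; [|exact: le_lt_trans rt|exact: (kernel_gt0 QK)].
congr (mu _); apply/seteqP; split=> z; rewrite /ysection/= inE/=; first by move=> [[]].
by move=> [].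
Qed.

Lemma measurable_ball_density (r : R) (b : itv_bound R) : (0 <= r)%R ->
  measurable_fun [set` Interval (BRight r) b] ball_density.
Proof.
move=> r0; have := measurable_ball_densityI setT r b measurableT r0.
by apply: eq_measurable_fun => t _; rewrite setTI.
Qed.

End BallDensity.

Lemma ae_borelS {R : realType} {X : pointedMetricType R}
    (mu : {sigma_finite_measure set (borel X) -> \bar R}) (P Q : X -> Prop) :
  (forall y, P y -> Q y) -> (\forall y \ae mu, P y) -> \forall y \ae mu, Q y.
Proof. move=> PQ; exact: (@filterS _ _ (ae_filter_ringOfSetsType mu) P Q PQ). Qed.

Lemma ae_ex {R : realType} {X : pointedMetricType R}
    (mu : {sigma_finite_measure set (borel X) -> \bar R}) (B : set (borel X)) (P : X -> Prop) :
  measurable B -> 0 < mu B -> (\forall y \ae mu, P y) -> exists2 y, B y & P y.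
Proof.
move=> mB muB aeP; apply: contrapT => nex.
have /negligibleP : mu.-negligible B.
  by apply: negligibleS aeP => y By Py; apply: nex; exists y.
by move=> /(_ mB) B0; move: muB; rewrite B0 ltxx.
Qed.

(** * Lower bounds for supersolutions of u = K(u^q) *)

Section Blowup.
Context {R : realType} {X : pointedMetricType R}.
Context (kappa q : R) (K : X -> X -> \bar R).
Context (sigma : {sigma_finite_measure set (borel X) -> \bar R}).
Context (u : borel X -> R) (x : X).
Context (k1 : (1 <= kappa)%R) (q1 : (1 < q)%R) (QK : quasi_metric_kernel kappa K).
Context (hu : borel_nonneg u).
Context (hsup : \forall y \ae sigma,
  kernel_op K sigma (fun y => (u y `^ q)%:E) y <= (u y)%:E).

Let K0 := kernel_gt0 QK.
Let kap0 : (0 < kappa)%R := lt_le_trans ltr01 k1.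
Let mK y : measurable_fun setT (K y : borel X -> \bar R) :=
  @measurable_kernel_section R X kappa K y QK.
Let mB t (t0 : (0 < t)%R) : measurable (kball K t x) := measurable_kball kappa K x t t0 QK.
Let F := ball_density K sigma x.

Lemma kernel_op_ge (D : set (borel X)) (lam : R) (y : X) : measurable D -> (0 <= lam)%R ->
  (\forall z \ae sigma, D z -> (lam <= u z)%R) ->
  (lam `^ q)%:E * \int[sigma]_(z in D) K y z <= kernel_op K sigma (fun y => (u y `^ q)%:E) y.
Proof.
move=> mD lam0 ulam; have [mu u0] := hu.
have q0 : (0 <= q)%R by rewrite ltW// (lt_trans ltr01).
have muq : measurable_fun setT (fun z : borel X => K y z * (u z `^ q)%:E).
  apply: emeasurable_funM; first exact: mK.
  apply/measurable_EFinP.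
  have mp : measurable_fun [set: R] (fun s : R => s `^ q)%R by exact: measurable_powR.
  exact: (measurableT_comp mp mu).
have Kuq0 z : 0 <= K y z * (u z `^ q)%:E.
  by rewrite mule_ge0 ?lee_fin ?powR_ge0// ltW.
have mKD : measurable_fun D (K y : borel X -> \bar R) := measurable_funTS (mK y).
have K0D z : D z -> 0 <= K y z by move=> _; exact: ltW.
have lamq0 : 0 <= (lam `^ q)%:E by rewrite lee_fin powR_ge0.
rewrite -(ge0_integralZl sigma mD mKD K0D lamq0).
apply: le_trans (_ : _ <= \int[sigma]_(z in D) (K y z * (u z `^ q)%:E)) _; last first.
  exact: ge0_subset_integral.
apply: ae_ge0_le_integral => //.
- by move=> z _; rewrite mule_ge0 ?lee_fin ?powR_ge0// ltW.
- by apply: measurable_funeM; exact: measurable_funTS (mK y).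
- exact: measurable_funTS.
- apply: filterS ulam => z ulam Dz; rewrite muleC; apply: lee_wpmul2l; first exact: ltW.
  by rewrite lee_fin ge0_ler_powR ?nnegrE// ulam.
Qed.

(** For t in ]r, b] the ball B_t lies in B_b, so truncating sigma to B_b, where
    the lower bound lam is available, does not change the radial integral. *)
Lemma ball_gain r b lam : (0 < r <= b)%R -> (0 <= lam)%R ->
  (\forall z \ae sigma, kball K b x z -> (lam <= u z)%R) ->
  \forall y \ae sigma, kball K r x y ->
    ((2 * kappa)^-1 * lam `^ q)%:E * \int[lebesgue_measure]_(t in `]r, b]) F t <= (u y)%:E.
Proof.
move=> /andP[r0 rb] lam0 ulam; have b0 : (0 < b)%R := lt_le_trans r0 rb.
apply: ae_borelS hsup => y uy xy; apply: le_trans uy.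
apply: le_trans (kernel_op_ge (kball K b x) lam y (mB _ b0) lam0 ulam).
rewrite mulrC EFinM -muleA lee_wpmul2l ?lee_fin ?powR_ge0//.
apply: le_trans (potential_ge_ball kappa K sigma (kball K b x) x y r k1 QK r0 xy (mB _ b0)).
rewrite lee_wpmul2l ?lee_fin ?invr_ge0 ?mulr_ge0 ?(ltW kap0)//.
have -> : \int[lebesgue_measure]_(t in `]r, b]) F t = \int[lebesgue_measure]_(t in `]r, b])
   (sigma (kball K b x `&` kball K t x) * (t ^- 2)%:E).
  apply: eq_integral => t; rewrite inE/= in_itv/= => /andP[rt tb].
  by rewrite setIidr//; exact: subset_kball.
apply: ge0_subset_integral => //.
- by apply: (measurable_ball_densityI kappa) => //; [exact: mB|exact: ltW].
- by move=> t _; rewrite mule_ge0// lee_fin invr_ge0 exprn_even_ge0.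
- by apply: subset_itvl; rewrite bnd_simp.
Qed.

(** For y, z in B_a one has K(y, z) >= 1 / (2 kappa a), so an infinite mass of
    B_a would give u = +oo on B_a. *)
Lemma kball_fin a lam : (0 < a)%R -> (0 < lam)%R ->
  (\forall z \ae sigma, kball K a x z -> (lam <= u z)%R) ->
  sigma (kball K a x) < +oo.
Proof.
move=> a0 lam0 ulam; rewrite ltey; apply/eqP => sy.
have [y ay uy] : exists2 y, kball K a x y &
    kernel_op K sigma (fun y => (u y `^ q)%:E) y <= (u y)%:E.
  by apply: (ae_ex _ _ _ (mB a a0) _ hsup); rewrite sy.
suff : +oo <= (u y)%:E by rewrite leye_eq.
apply: le_trans uy.
apply: le_trans (kernel_op_ge (kball K a x) lam y (mB _ a0) (ltW lam0) ulam).
have c0 : (0 < (2 * kappa)^-1 * a^-1)%R by rewrite mulr_gt0 ?invr_gt0 ?mulr_gt0.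
have : \int[sigma]_(z in kball K a x) ((2 * kappa)^-1 * a^-1)%:E <=
    \int[sigma]_(z in kball K a x) K y z.
  apply: ge0_le_integral => //.
  - exact: mB.
  - by move=> z _; rewrite lee_fin ltW.
  - exact: measurable_funTS (mK y).
  - move=> z az; apply: le_trans (kernel_ge_ball kappa K x y z a k1 QK a0 ay).
    rewrite EFinM lee_wpmul2l ?lee_fin ?invr_ge0 ?mulr_ge0 ?(ltW kap0)// le_min lexx/=.
    move: az; rewrite kballE//=.
    case: (K x z) (K0 x z) => [s||]//; rewrite ?leey// lte_fin => s0.
    by rewrite -EFinM !lee_fin mulrC -ler_pdivrMr ?div1r.
rewrite integral_cst; last exact: mB.
rewrite [X in _ * X]sy.
rewrite gt0_muley ?lte_fin// => intK.
have -> : \int[sigma]_(z in kball K a x) K y z = +oo by apply/eqP; rewrite -leye_eq.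
by rewrite gt0_muley ?lte_fin// powR_gt0.
Qed.

Let P : R := (2 `^ (q - 1))%R.
Let D : R := (2 / (1 - P^-1))%R.

(** The sum of the geometric series with first term 4 kappa / lam^(q-1) and ratio
    2^(1-q): the n-th term is the mass that doubles the bound 2^n lam. *)
Definition blowup_mass (lam : R) : R := (D * (2 * kappa) / lam `^ (q - 1))%R.

Let P1 : (1 < P)%R.
Proof.
have : (1 `^ (q - 1) < P)%R by rewrite gt0_ltr_powR ?subr_gt0 ?nnegrE// ltr1n.
by rewrite powR1.
Qed.

Let D2 : (2 <= D)%R.
Proof.
have P0 : (0 < P)%R by rewrite (lt_trans ltr01 P1).
rewrite /D ler_pdivlMr ?subr_gt0 ?invf_lt1//.
by rewrite ger_pMr// gerBl invr_ge0 ltW.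
Qed.

(* Removing the first term from the geometric series divides it by P, which is
   the effect of replacing lam by 2 lam in blowup_mass. *)
Let DP : (D / P = D - 2)%R.
Proof.
have : (D * (1 - P^-1) = 2)%R.
  by rewrite /D divfK// subr_eq0 gt_eqF// invf_lt1// (lt_trans ltr01 P1).
by rewrite mulrBr mulr1 => <-; rewrite subKr.
Qed.

Lemma blowup_mass_ge0 lam : (0 <= blowup_mass lam)%R.
Proof.
apply: divr_ge0; last exact: powR_ge0.
apply: mulr_ge0; first exact: le_trans D2.
by rewrite mulr_ge0// ltW.
Qed.

(** Induction on the number of doublings: the intermediate radius c is chosen
    such that ]c, b] carries exactly the mass v needed to double the bound on
    B_c by ball_gain, and the mass left on ]r, c] is at least
    blowup_mass (2 lam). *)
Lemma ball_blowup n r b lam : (0 < r <= b)%R -> (0 < lam)%R ->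
  sigma (kball K b x) < +oo ->
  (blowup_mass lam)%:E <= \int[lebesgue_measure]_(t in `]r, b]) F t ->
  (\forall y \ae sigma, kball K b x y -> (lam <= u y)%R) ->
  \forall y \ae sigma, kball K r x y -> (2 ^+ n * lam <= u y)%R.
Proof.
elim: n b lam => [|n IH] b lam /andP[r0 rb] lam0 bfin mass ulam.
  apply: ae_borelS ulam => y uy ry; rewrite expr0 mul1r; apply: uy.
  exact: subset_kball ry.
have P0 : (0 < P)%R := lt_trans ltr01 P1.
have L0 : (0 < lam `^ (q - 1))%R by exact: powR_gt0.
have b0 : (0 < b)%R := lt_le_trans r0 rb.
pose v : R := (2 * (2 * kappa) / lam `^ (q - 1))%R.
have v0 : (0 <= v)%R by rewrite !mulr_ge0// ?invr_ge0 ltW.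
have vle : (v <= blowup_mass lam)%R.
  by rewrite /v /blowup_mass !ler_pM2r ?invr_gt0// ?mulr_gt0.
have mF : measurable_fun `]r, b] F by apply: (measurable_ball_density kappa) => //; exact: ltW.
have FM t : (r < t <= b)%R -> 0 <= F t <= (fine (sigma (kball K b x)) * r ^- 2)%:E.
  move=> /andP[rt tb]; have t0 : (0 < t)%R := lt_trans r0 rt.
  rewrite ball_density_ge0/= EFinM fineK; last first.
    by rewrite ge0_fin_numE.
  apply: lee_pmul => //; rewrite ?lee_fin ?invr_ge0 ?exprn_even_ge0//.
  - exact: (le_measure_kball kappa).
  - rewrite lef_pV2 ?posrE ?exprn_gt0//.
    by rewrite lerXn2r ?nnegrE ?(ltW r0) ?(ltW t0) ?(ltW rt).
have M0 : (0 <= fine (sigma (kball K b x)) * r ^- 2)%R.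
  by rewrite mulr_ge0 ?fine_ge0// invr_ge0 exprn_even_ge0.
have vmass : v%:E <= \int[lebesgue_measure]_(t in `]r, b]) F t.
  by apply: le_trans mass; rewrite lee_fin.
have [c /andP[rc cb] cv] := integral_tail_IVT F r b _ v rb M0 mF FM v0 vmass.
have split := integral_itvoc_split F r c b.
rewrite exprS -mulrA mulrCA; apply: (IH c) => //.
- by rewrite r0.
- by rewrite mulr_gt0.
- by apply: le_lt_trans bfin; apply: (le_measure_kball kappa) => //; exact: lt_le_trans rc.
- move: mass; rewrite split ?rc// ?cv; last first.
    by move=> t _; exact: ball_density_ge0.
  rewrite -leeBlDr// -EFinB; apply: le_trans; rewrite lee_fin.
  rewrite /blowup_mass powRM ?(ltW lam0)// -/P /v -!mulrBl -DP invfM le_eqVlt; apply/orP; left.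
  by apply/eqP; ring.
- have := ball_gain c b lam _ (ltW lam0) ulam.
  rewrite cv (lt_le_trans r0 rc) cb => /(_ isT).
  apply: ae_borelS => y uy cy; have := uy cy; rewrite -EFinM lee_fin.
  apply: le_trans; rewrite /v.
  have -> : (lam `^ q = lam * lam `^ (q - 1))%R.
    by rewrite mulr_powRB1 ?ltW// (lt_trans ltr01).
  rewrite le_eqVlt; apply/orP; left; apply/eqP; field.
  by rewrite !gt_eqF.
Qed.

(** Otherwise, as B_r is not null, some point of B_r would satisfy all the bounds
    2^n lam <= u at once. *)
Lemma ball_tail_le r a lam : (0 < r <= a)%R -> (0 < lam)%R ->
  (\forall y \ae sigma, kball K a x y -> (lam <= u y)%R) -> 0 < sigma (kball K r x) ->
  \int[lebesgue_measure]_(t in `]r, a]) F t <= (blowup_mass lam)%:E.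
Proof.
move=> /andP[r0 ra] lam0 ulam sr; have a0 : (0 < a)%R := lt_le_trans r0 ra.
rewrite leNgt; apply/negP => /ltW mass.
have afin := kball_fin a lam a0 lam0 ulam.
have big n : \forall y \ae sigma, kball K r x y -> (2 ^+ n * lam <= u y)%R.
  by apply: (ball_blowup n r a lam) => //; rewrite r0.
have [y ry uy] := ae_ex _ _ _ (mB r r0) sr (ae_foralln big).
have u0 : (0 <= u y / lam)%R by rewrite divr_ge0 ?(ltW lam0)//; case: hu.
have := archi_boundP u0; set n := Num.bound _ => un.
have := uy n ry; rewrite leNgt => /negP; apply; rewrite -ltr_pdivrMr//.
by rewrite (lt_trans un)// -natrX ltr_nat ltn_expl.
Qed.

(** Below inf S the balls are null and F vanishes; above it ball_tail_le applies,
    and monotone convergence on ]inf S + 1/(n+1), a] gives the whole interval.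
    One cannot let r tend to 0 directly, since the blow-up on B_r is
    contradictory only if sigma(B_r) > 0. *)
Lemma ball_mass_le a lam : (0 < a)%R -> (0 < lam)%R ->
  (\forall y \ae sigma, kball K a x y -> (lam <= u y)%R) -> 0 < sigma (kball K a x) ->
  \int[lebesgue_measure]_(t in `]0%R, a]) F t <= (blowup_mass lam)%:E.
Proof.
move=> a0 lam0 ulam sa.
pose S := [set r : R | (0 < r)%R /\ 0 < sigma (kball K r x)].
have Sinf : has_inf S.
  by split; [exists a|exists 0%R => r [/ltW]].
have r00 : (0 <= inf S)%R by apply: lb_le_inf; [exists a|move=> r [/ltW]].
have r0a : (inf S <= a)%R by apply: ge_inf; [case: Sinf|].
have mF (r : R) (b : itv_bound R) : (0 <= r)%R -> measurable_fun [set` Interval (BRight r) b] F.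
  exact: (measurable_ball_density kappa).
have F0 t : 0 <= F t by exact: ball_density_ge0.
have Fz t : (0 < t)%R -> (t < inf S)%R -> F t = 0.
  move=> t0 tS; rewrite /F /ball_density.
  have [st|] := ltP 0 (sigma (kball K t x)).
    by move: tS; rewrite ltNge ge_inf//; case: Sinf.
  by rewrite le_eqVlt ltNge measure_ge0 orbF => /eqP ->; rewrite mul0e.
have mass0 : 0 <= (blowup_mass lam)%:E.
  have aa : (0 < a <= a)%R by rewrite a0 lexx.
  by apply: le_trans (ball_tail_le a a lam aa lam0 ulam sa); exact: integral_ge0.
rewrite (integral_itvoc_split F 0 (inf S) a) ?r00 ?r0a//; last exact: mF.
rewrite -integral_itv_bndo_bndc; last exact: mF.
rewrite integral0_eq ?add0e; last first.
  by move=> t /=; rewrite in_itv/= => /andP[t0 tS]; exact: Fz.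
pose E n := `](inf S + n.+1%:R^-1)%R, a]%classic.
have -> : `](inf S), a]%classic = \bigcup_n E n.
  apply/seteqP; split=> t.
    rewrite /= in_itv/= => /andP[St ta].
    have tS0 : (0 < t - inf S)%R by rewrite subr_gt0.
    have [n _ /(_ n (leqnn _)) /= tn] := near_infty_natSinv_lt (PosNum tS0).
    exists n => //.
    by rewrite /E/= in_itv/= ta andbT -ltrBrDl.
  move=> [n _]; rewrite /E/= !in_itv/= => /andP[St ->]; rewrite andbT.
  by apply: le_lt_trans St; rewrite lerDl.
have cvgE : \int[lebesgue_measure]_(t in E i) F t @[i --> \oo] -->
    \int[lebesgue_measure]_(t in \bigcup_i E i) F t.
  apply: ge0_nondecreasing_set_cvg_integral => //.
  - move=> m n mn; rewrite subsetEset; apply: subset_itvr; rewrite bnd_simp.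
    by rewrite lerD2l lef_pV2 ?posrE// ler_nat ltnS.
  - by move=> n; exact: measurable_itv.
  - by move=> n; apply: mF; rewrite addr_ge0.
rewrite -(cvg_lim _ cvgE)//; apply: lime_le; first by apply/cvg_ex; eexists; exact: cvgE.
apply: nearW => n /=; rewrite /E; set r := (inf S + _)%R.
have [ra|ar] := leP r a; last first.
  by rewrite set_itv_ge ?integral_set0// -leNgt bnd_simp ltW.
have eps0 : (0 < n.+1%:R^-1 :> R)%R by rewrite invr_gt0.
have [s [s0 ss] sr] := inf_adherent eps0 Sinf.
apply: ball_tail_le => //; first by rewrite ra (lt_trans s0).
by apply: lt_le_trans ss _; apply: (le_measure_kball kappa) => //; exact: ltW.
Qed.

End Blowup.

(** * The estimate relating the two measures *)

Theorem theorem3p10 (R : realType) (kappa p q : R)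
    (hkappa : (1 <= kappa)%R) (hq : (1 < q)%R) (hpq : (p^-1 + q^-1 = 1)%R) :
  exists C : R,
    forall (X : pointedMetricType R) (K : X -> X -> \bar R)
      (sigma omega : {sigma_finite_measure set (borel X) -> \bar R}),
      quasi_metric_kernel kappa K ->
      Z_class q K sigma (potential K omega) ->
      forall x : X,
        ereal_sup
          [set ((\int[lebesgue_measure]_(t in `]0%R, a])
                   (sigma (kball K t x) * (t ^- 2)%:E)) `^ (p / q))
               * (\int[lebesgue_measure]_(t in `]a, +oo[)
                   (omega (kball K t x) * (t ^- 2)%:E))
          | a in [set a : R | (0 < a)%R]]
        <= C%:E * Z_norm q K sigma (potential K omega).
Proof.
have q0 : (0 < q)%R := lt_trans ltr01 hq.
have q10 : (0 < q - 1)%R by rewrite subr_gt0.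
have kap0 : (0 < kappa)%R := lt_le_trans ltr01 hkappa.
have pq : (p / q = (q - 1)^-1)%R.
  have -> : (p = (1 - q^-1)^-1)%R by rewrite -hpq addrK invrK.
  by rewrite -invfM mulrBl mul1r mulVf// gt_eqF.
pose c := blowup_mass kappa q 1%R.
have c0 : (0 <= c)%R by exact: blowup_mass_ge0.
(* the summand 1 makes C positive without looking into c, so that one may divide
   by C *)
pose C := (2 * kappa * (1 + c `^ (q - 1)^-1))%R.
have C0 : (0 < C)%R by rewrite !mulr_gt0// ltr_pwDl// powR_ge0.
exists C => X K sigma omega QK _ x.
rewrite -lee_pdivrMl//; apply: le_ereal_inf_tmp => _ [alpha [alpha0 [_ [u hu aeu]]] <-].
rewrite lee_pdivrMl//; apply: ge_ereal_sup => _ [a a0 <-]; rewrite pq.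
set I := (X in _ * X); set J := (X in X `^ _ * _).
have pot0 (y : X) : 0 <= potential K omega y.
  by apply: integral_ge0 => z _; rewrite ltW// (kernel_gt0 QK).
have hsup : \forall y \ae sigma, kernel_op K sigma (fun y => (u y `^ q)%:E) y <= (u y)%:E.
  apply: ae_borelS aeu => y ->; rewrite leeDl// mule_ge0 ?lee_fin ?invr_ge0 ?(ltW alpha0)//.
have hI : \forall y \ae sigma, kball K a x y ->
    (alpha^-1 * (2 * kappa)^-1)%:E * I <= (u y)%:E.
  apply: ae_borelS aeu => y -> ay; rewrite gee0_abs//.
  have kop0 : 0 <= kernel_op K sigma (fun y => (u y `^ q)%:E) y.
    by apply: integral_ge0 => z _; rewrite mule_ge0 ?lee_fin ?powR_ge0// ltW// (kernel_gt0 QK).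
  apply: (@le_trans _ _ ((alpha^-1)%:E * potential K omega y)); last by rewrite leeDr.
  rewrite EFinM -muleA lee_wpmul2l ?lee_fin ?invr_ge0 ?(ltW alpha0)//.
  have := potential_ge_ball kappa K omega setT x y a hkappa QK a0 ay measurableT.
  by under eq_integral do rewrite setTI.
have I0 : 0 <= I by apply: integral_ge0 => t _; exact: (ball_density_ge0 K omega x t).
have RHS0 : 0 <= C%:E * alpha%:E by rewrite mule_ge0 ?lee_fin ?(ltW C0) ?(ltW alpha0).
have mB t : (0 < t)%R -> measurable (kball K t x).
  by move=> t0; exact: (measurable_kball kappa).
have [sa|] := ltP 0 (sigma (kball K a x)); last first.
  move=> sa; have -> : J = 0.
    apply: integral0_eq => t /=; rewrite in_itv/= => /andP[t0 ta].
    have := le_trans (le_measure_kball kappa K sigma x QK t a t0 ta) sa.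
    by rewrite measure_le0 => /eqP ->; rewrite mul0e.
  by rewrite poweR0r ?mul0e// invr_eq0 gt_eqF.
(* u is finite at some point of B_a, hence so is I *)
have [y ay uy] := ae_ex _ _ _ (mB a a0) sa hI.
have {uy} := uy ay.
(* for I = 0 the bound lam below would be 0, but then the product vanishes *)
have [->|In0] := eqVneq I 0; first by rewrite !mule0.
have {I0 In0} : 0 < I by rewrite lt_neqAle eq_sym In0.
have cc0 : (0 < alpha^-1 * (2 * kappa)^-1)%R by rewrite mulr_gt0 ?invr_gt0 ?mulr_gt0.
case II: I => [i| |]; [|by rewrite gt0_muley ?lte_fin// leye_eq|by []].
rewrite lte_fin => i0 _.
pose lam := (alpha^-1 * (2 * kappa)^-1 * i)%R.
have lam0 : (0 < lam)%R by rewrite mulr_gt0.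
have hlam : \forall y \ae sigma, kball K a x y -> (lam <= u y)%R.
  by apply: ae_borelS hI => z iz az; rewrite -lee_fin; have := iz az; rewrite II.
have Jle := ball_mass_le kappa q K sigma u x hkappa hq QK hu hsup a lam a0 lam0 hlam sa.
have Jle' : J `^ (q - 1)^-1 <= (blowup_mass kappa q lam)%:E `^ (q - 1)^-1.
  have J0 : 0 <= J by apply: integral_ge0 => t _; exact: (ball_density_ge0 K sigma x t).
  apply: gt0_ler_poweR => //; rewrite ?in_itv/= ?leey ?andbT//.
  - by rewrite invr_ge0 ltW.
  - by rewrite lee_fin; exact: blowup_mass_ge0.
apply: le_trans (lee_wpmul2r _ Jle') _.
  by rewrite lee_fin ltW.
rewrite poweR_EFin -!EFinM lee_fin.
have -> : (blowup_mass kappa q lam = c / lam `^ (q - 1))%R.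
  by rewrite /c /blowup_mass powR1 divr1.
have L0 : (0 < lam `^ (q - 1))%R by exact: powR_gt0.
have cE : ((c / lam `^ (q - 1)) `^ (q - 1)^-1 * lam = c `^ (q - 1)^-1)%R.
  have {2}-> : (lam = (lam `^ (q - 1)) `^ (q - 1)^-1)%R.
    by rewrite -powRrM mulfV ?gt_eqF// powRr1// ltW.
  rewrite -powRM ?divfK ?gt_eqF//; last exact: ltW.
  by rewrite divr_ge0// ltW.
have -> : (i = lam * (2 * kappa * alpha))%R.
  by rewrite /lam; field; rewrite !gt_eqF.
rewrite mulrA cE /C mulrCA mulrA ler_pM2r// ler_pM2l ?mulr_gt0//.
by rewrite lerDr.
Qed.
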